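(* Let $S$ be a set; all complexes are over $S$ and isomorphism classes are taken over $S$. (1) If $K_1,K_2$ are isomorphism classes of simplicial complexes whose vertex sets do not have the same cardinality, then $d(K_1,K_2)=1$. (2) Let $X\subset S$ be a finite set of cardinality $q\geq1$, and let $1\leq p\leq q$ be an integer. Let $\mathcal{K}_1=\mathcal{P}^*_{\leq q-p}(X)$, $\mathcal{K}_2=\mathcal{P}_f^*(X)$, and let $K_1,K_2$ be the corresponding isomorphism classes. Then $d(K_1,K_2)=p/q$. (3) Let $(S_n)$ be a sequence of pairwise disjoint finite subsets of $S$ with $q_n=|S_n|$, and let $(p_n)$ be a sequence of integers with $1\leq p_n\leq q_n$. Let $\mathcal{K}_1=\bigsqcup_n\mathcal{P}^*_{\leq q_n-p_n}(S_n)$, $\mathcal{K}_2=\bigsqcup_n\mathcal{P}_f^*(S_n)$, and let $K_1,K_2$ be the corresponding isomorphism classes. Let $\alpha=\sup_n p_n/q_n$. If $\alpha\leq1/2$ and $(q_n)$ is strictly increasing, then $d(K_1,K_2)=\alpha$.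
   Context: For a set $X$, $\mathcal{P}_f^*(X)$ is the collection of all non-empty finite subsets of $X$, and $\mathcal{P}^*_{\leq k}(X)=\{E\in\mathcal{P}_f^*(X):|E|\leq k\}$. A simplicial complex over $S$ is a collection $\mathcal{K}\subset\mathcal{P}_f^*(S)$ such that every non-empty subset of an element of $\mathcal{K}$ belongs to $\mathcal{K}$. Its vertex set is $\bigcup\mathcal{K}$. $\Omega=[0,1]$ with Lebesgue measure $\lambda$. $L(\mathcal{K})$ is the set of measurable maps $f:\Omega\to S$, identified when equal almost everywhere, such that $f(\Omega)\in\mathcal{K}$, where $f(\Omega)$ denotes the set $\{s\in S : \lambda(f^{-1}(s))>0\}$ and $f$ takes its values in this set almost everywhere. The metric is $d(f,g)=\lambda(\{t\in\Omega : f(t)\neq g(t)\})$. The distance between simplicial complexes is the Hausdorff distance $d(\mathcal{K}_1,\mathcal{K}_2)=\max(\delta(\mathcal{K}_1,\mathcal{K}_2),\delta(\mathcal{K}_2,\mathcal{K}_1))$ with $\delta(\mathcal{K}_1,\mathcal{K}_2)=\sup_{f\in L(\mathcal{K}_1)}\inf_{g\in L(\mathcal{K}_2)}d(f,g)$. When one of the collections is empty, the conventions are that the infimum over the empty set is $1$ and the supremum over the empty set is $0$ (so the distance from the empty collection to a non-empty one is $1$). Let $\mathfrak{S}(S)$ be the group of all permutations of $S$, acting on simplicial complexes by $\sigma(\mathcal{K})=\{\sigma(F):F\in\mathcal{K}\}$. An isomorphism class is an orbit of this action, and $d(K_1,K_2)=\inf_{\mathcal{K}_1\in K_1,\,\mathcal{K}_2\in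 K_2}d(\mathcal{K}_1,\mathcal{K}_2)=\inf_{\sigma\in\mathfrak{S}(S)}d(\mathcal{K}_1,\sigma(\mathcal{K}_2))$ for any fixed representatives in the last expression. *)

(* Defs.v *)
From mathcomp Require Import all_boot all_order all_algebra.
From mathcomp Require Import all_classical all_reals all_analysis.
Set Implicit Arguments.
Unset Strict Implicit.
Unset Printing Implicit Defensive.
Import Order.TTheory GRing.Theory Num.Theory.
Import numFieldNormedType.Exports.
Local Open Scope classical_set_scope.
Local Open Scope ring_scope.

Definition finite_parts (S : Type) (X : set S) : set (set S) :=
  [set E | [/\ E `<=` X, finite_set E & E !=set0]].

Definition finite_parts_le (S : Type) (k : nat) (X : set S) : set (set S) :=
  [set E | finite_parts X E /\ (E #<= `I_k)%card].

Definition simplicial_complex (S : Type) (K : set (set S)) : Prop :=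
  K `<=` finite_parts [set: S] /\
  forall E F : set S, K E -> F !=set0 -> F `<=` E -> K F.

Definition vertices (S : Type) (K : set (set S)) : set S :=
  \bigcup_(E in K) E.

Definition unit_interval (R : realType) : set R := `[0, 1].
Arguments unit_interval : clear implicits.

Definition ess_image (R : realType) (S : Type) (f : R -> S) : set S :=
  [set s | (0 < completed_lebesgue_measure
                  (unit_interval R `&` f @^-1` [set s]))%E].

(* The elements of L(K) are represented by actual maps R -> S, of which only
   the restriction to [0, 1] matters. They are not quotiented by equality almost
   everywhere: membership in L(K) and the distance below are invariant under
   this relation, so that the suprema and infima over the quotient are the same.
   S carries the discrete sigma-algebra and [0, 1] the sigma-algebra of Lebesgue
   (Caratheodory) measurable sets. *)
Definition simplicial_maps (R : realType) (S : Type) (K : set (set S)) :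
    set (R -> S) :=
  [set f | [/\ forall A : set S,
                 (@wlength R idfun)^*%mu.-cara.-measurable
                   (unit_interval R `&` f @^-1` A),
               K (ess_image f)
             & \forall t \ae @completed_lebesgue_measure R,
                 unit_interval R t -> ess_image f (f t)]].
Arguments simplicial_maps R {S} K.

Definition map_dist (R : realType) (S : Type) (f g : R -> S) : R :=
  fine (completed_lebesgue_measure (unit_interval R `&` [set t | f t <> g t])).

(* [sup set0 = 0] and [infimum 1 set0 = 1] are the conventions for empty
   collections. *)
Definition one_sided_dist (R : realType) (S : Type) (K1 K2 : set (set S)) : R :=
  sup [set infimum 1 [set map_dist f g | g in simplicial_maps R K2]
      | f in simplicial_maps R K1].

Definition complex_dist (R : realType) (S : Type) (K1 K2 : set (set S)) : R :=
  Num.max (one_sided_dist R K1 K2) (one_sided_dist R K2 K1).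

Definition permute (S : Type) (s : S -> S) (K : set (set S)) : set (set S) :=
  [set s @` F | F in K].

Definition iso_class (S : Type) (K : set (set S)) : set (set (set S)) :=
  [set K' | exists2 s : S -> S, bijective s & K' = permute s K].

Definition class_dist (R : realType) (S : Type) (C1 C2 : set (set (set S))) : R :=
  inf [set complex_dist R K.1 K.2 | K in C1 `*` C2].

(* Main.v *)
Require Import Defs.
From mathcomp Require Import all_boot all_order all_algebra.
From mathcomp Require Import all_classical all_reals all_analysis.
From mathcomp Require Import zify lra.
Import Order.TTheory GRing.Theory Num.Theory.
Import numFieldNormedType.Exports.
Local Open Scope classical_set_scope.
Local Open Scope ring_scope.

(** All three values come from one lower bound and one upper bound.

    The lower bound is [one_sided_ge_missing]: let x_1, ..., x_q enumerate a
    simplex of a complex K, and suppose that every simplex of a complex K'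
    misses x_i for at least p of the indices i. The map f that takes the values
    x_1, ..., x_q on q consecutive intervals of length 1/q differs from any g in
    L(K') on all the intervals whose value is missed by the essential image of
    g, so that d(f, g) >= p/q. With q = 1 this says that complexes at distance
    less than 1 have the same vertices; with q = 2, that two points spanning an
    edge of one complex but no edge of the other force the distance to be at
    least 1/2.

    The upper bound is [recolour_light]: if f takes its values in a set of q
    points and p < q, the p least frequent of these values have total frequency
    at most p/q, and replacing them by another value moves f by at most p/q
    into the complex of simplices with at most q - p vertices.

    When the vertex sets are not equipotent, no permutation makes them equal,
    and the lower bound with q = 1 gives the distance 1. For a simplex and its
    skeleton, the two bounds agree.

    For a disjoint union of blocks, the identity permutation gives the upper
    bound, as the essential image of a map lies in a single block. For the lower
    bound, suppose that some relabellings A_n and B_n of the blocks of K1 and K2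
    give a distance d < alpha <= 1/2. The two complexes have the same vertices,
    and since d < 1/2 any two points of a B_m lie in a common A_k, so that each
    B_m is contained in some A_k. The sizes being strictly increasing, this
    forces A_n = B_n for all n ([blocks_eq]). Then a simplex of the relabelled
    K1 misses at least p_n points of each B_n, so that d >= p_n/q_n for all n,
    and d >= alpha, a contradiction. *)

(** * Lebesgue measure of the unit interval *)

(** As [completed_lebesgue_measure] is an outer measure, this is defined on all
    subsets; monotonicity and subadditivity hold without measurability. *)
Definition prob (R : realType) (A : set R) : R :=
  fine (completed_lebesgue_measure (unit_interval R `&` A)).

Definition event (R : realType) (A : set R) : Prop :=
  (@wlength R idfun)^*%mu.-cara.-measurable (unit_interval R `&` A).

Lemma event_measurable (R : realType) (A : set R) : measurable A -> event R A.
Proof.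
move=> mA; apply: sub_caratheodory.
by apply: measurableI => //; exact: measurable_itv.
Qed.

Lemma le_lebesgue (R : realType) (A B : set R) : A `<=` B ->
  (completed_lebesgue_measure A <= completed_lebesgue_measure B)%E.
Proof. by move=> AB; apply: le_outer_measure. Qed.

Lemma completed_lebesgue_itv (R : realType) (i : interval R) :
  completed_lebesgue_measure [set` i] = lebesgue_measure ([set` i] : set R).
Proof. by []. Qed.

Lemma lebesgue_unit (R : realType) :
  completed_lebesgue_measure (unit_interval R) = 1%E.
Proof.
rewrite /unit_interval completed_lebesgue_itv lebesgue_measure_itv /=.
by rewrite lte_fin ltr01 oppr0 adde0.
Qed.

Lemma probE (R : realType) (A : set R) :
  (prob R A)%:E = completed_lebesgue_measure (unit_interval R `&` A).
Proof.
rewrite /prob fineK// ge0_fin_numE; last exact: outer_measure_ge0.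
apply: (@le_lt_trans _ _ (completed_lebesgue_measure (unit_interval R))).
  by apply: le_lebesgue.
by rewrite lebesgue_unit ltry.
Qed.

Lemma prob_ge0 (R : realType) (A : set R) : 0 <= prob R A.
Proof. by rewrite -lee_fin probE; exact: outer_measure_ge0. Qed.

Lemma le_prob (R : realType) (A B : set R) :
  unit_interval R `&` A `<=` B -> prob R A <= prob R B.
Proof.
move=> AB; rewrite -lee_fin !probE; apply: le_lebesgue => t At.
by split; [case: At | apply: AB].
Qed.

Lemma prob_le1 (R : realType) (A : set R) : prob R A <= 1.
Proof. by rewrite -lee_fin probE -(lebesgue_unit R); apply: le_lebesgue. Qed.

Lemma probU_le (R : realType) (A B : set R) :
  prob R (A `|` B) <= prob R A + prob R B.
Proof. by rewrite -lee_fin EFinD !probE setIUr; exact: outer_measureU2. Qed.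

Lemma prob0 (R : realType) : prob R set0 = 0.
Proof. by apply: EFin_inj; rewrite probE setI0; exact: outer_measure0. Qed.

Lemma prob_ae0 (R : realType) (A : set R) :
  (\forall t \ae @completed_lebesgue_measure R, unit_interval R t -> ~ A t) ->
  prob R A = 0.
Proof.
move=> [N [mN N0 AN]]; apply/eqP; rewrite eq_le prob_ge0 andbT -lee_fin probE.
have <- : completed_lebesgue_measure N = 0%:E by [].
by apply: le_lebesgue => t [ut At]; apply: AN => /(_ ut).
Qed.

Lemma sub_ae (R : realType) (A B : set R) : A `<=` B ->
  (\forall t \ae @completed_lebesgue_measure R, A t) ->
  \forall t \ae @completed_lebesgue_measure R, B t.
Proof.
move=> AB [N [mN N0 AN]]; exists N; split => // t nBt; apply: AN => At.
exact/nBt/AB.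
Qed.

Lemma prob_bigcup (R : realType) (n : nat) (P : pred 'I_n) (F : 'I_n -> set R) :
  (forall i, event R (F i)) -> trivIset setT F ->
  prob R (\bigcup_(i in [set` P]) F i) = \sum_(i | P i) prob R (F i).
Proof.
move=> mF tF; apply: EFin_inj; rewrite probE setI_bigcupr bigcup_pred.
rewrite -sumEFin; under [RHS]eq_bigr => i _ do rewrite probE.
rewrite (eq_bigl P)//.
apply: (measure_bigsetU_ord completed_lebesgue_measure) => //.
exact: trivIset_setIl.
Qed.

(** * Maps into a complex *)

Definition grid_cell (R : realType) (q i : nat) : set R :=
  `[i%:R / q%:R, i.+1%:R / q%:R[.

Lemma grid_cell_trivIset (R : realType) (q : nat) :
  trivIset [set: 'I_q] (fun i : 'I_q => grid_cell R q i).
Proof.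
case: q => [|q]; first by move=> [].
have disj (m n : nat) t : (m < n)%N ->
    grid_cell R q.+1 m t -> grid_cell R q.+1 n t -> False.
  move=> mn; rewrite /grid_cell /= !in_itv /= => /andP[_ tm] /andP[nt _].
  have := le_lt_trans nt tm; rewrite ltr_pM2r ?invr_gt0 ?ltr0n// ltr_nat.
  by rewrite ltnS leqNgt mn.
move=> i j _ _ [t [ti tj]]; apply/val_inj.
by case: (ltngtP i j) => // ij;
  [case: (disj _ _ _ ij ti tj) | case: (disj _ _ _ ij tj ti)].
Qed.

Lemma grid_cell_event (R : realType) (q i : nat) : event R (grid_cell R q i).
Proof. by apply: event_measurable; exact: measurable_itv. Qed.

Lemma prob_grid_cell (R : realType) (q i : nat) :
  (i < q)%N -> prob R (grid_cell R q i) = q%:R^-1.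
Proof.
move=> iq; have q0 : 0 < q%:R :> R by rewrite ltr0n (leq_ltn_trans _ iq).
apply: EFin_inj; rewrite probE setIidr.
  rewrite /grid_cell completed_lebesgue_itv lebesgue_measure_itv /= lte_fin.
  rewrite ltr_pM2r ?invr_gt0// ltr_nat ltnSn -EFinB -mulrBl -natrB//.
  by rewrite subSnn mul1r.
move=> t; rewrite /grid_cell /unit_interval /= !in_itv /= => /andP[it ti].
rewrite (le_trans _ it) ?divr_ge0 ?ler0n//= (le_trans (ltW ti))//.
by rewrite ler_pdivrMr// mul1r ler_nat.
Qed.

(** Relabelling values creates no new essential value, because almost all values
    of f are essential; it loses none, because the fibres of phi o f contain
    those of f. *)
Lemma ess_image_comp (R : realType) (S T : Type) (f : R -> S) (phi : S -> T) :
  (\forall t \ae @completed_lebesgue_measure R,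
     unit_interval R t -> ess_image f (f t)) ->
  ess_image (phi \o f) = phi @` ess_image f.
Proof.
move=> fE; apply/seteqP; split=> [u|_ [s fs <-]].
- rewrite /ess_image /= -probE lte_fin => u0; apply: contrapT => nu.
  suff u00 : prob R ((phi \o f) @^-1` [set u]) = 0 by rewrite u00 ltxx in u0.
  apply: prob_ae0; apply: sub_ae fE => t fE ut /= ftu.
  by apply: nu; exists (f t); first exact: fE.
- apply: (lt_le_trans fs); apply: le_lebesgue => t [ut ft].
  by split=> //=; rewrite ft.
Qed.

Lemma simplicial_maps_comp (R : realType) (S : Type) (K1 K2 : set (set S))
    (f : R -> S) (phi : S -> S) :
  simplicial_maps R K1 f -> K2 (phi @` ess_image f) ->
  simplicial_maps R K2 (phi \o f).
Proof.
move=> [mf _ fE] K2f; rewrite /simplicial_maps /= ess_image_comp//; split => //.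
  by move=> A; have := mf (phi @^-1` A).
by apply: sub_ae fE => t fE ut; exists (f t); first exact: fE.
Qed.

(** The maps that witness the lower bounds. *)
Lemma uniform_map_exists (R : realType) (S : Type) (K : set (set S)) (q : nat)
    (x : 'I_q.+1 -> S) :
  K (range x) ->
  exists2 f, simplicial_maps R K f &
    forall i : 'I_q.+1, {in grid_cell R q.+1 i, forall t, f t = x i}.
Proof.
move=> Kx.
(* Within the unit interval only t = 1 lies outside the cells; giving it one of
   the values x i keeps all the values of f in range x. *)
pose f t := if pselect (exists i : 'I_q.+1, grid_cell R q.+1 i t) is left e
            then x (projT1 (cid e)) else x ord0.
have fx (i : 'I_q.+1) t : grid_cell R q.+1 i t -> f t = x i.
  move=> it; rewrite /f; case: pselect => [e|[]]; last by exists i.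
  case: cid => j /= jt; congr x; apply: (@grid_cell_trivIset R) => //.
  by exists t.
have fV t : range x (f t) by rewrite /f; case: pselect => *; eexists.
exists f; last by move=> i t; rewrite inE; exact: fx.
have fE : ess_image f = range x.
  apply/seteqP; split=> [s|_ [i _ <-]].
  - rewrite /ess_image /= -probE lte_fin => s0; apply: contrapT => ns.
    suff s00 : prob R (f @^-1` [set s]) = 0 by rewrite s00 ltxx in s0.
    rewrite -[RHS](prob0 R); congr (prob R _).
    by apply/seteqP; split => // t /= fs; apply: ns; rewrite -fs; exact: fV.
  - rewrite /ess_image /= -probE lte_fin.
    apply: (@lt_le_trans _ _ (prob R (grid_cell R q.+1 i))).
      by rewrite prob_grid_cell// invr_gt0 ltr0n.
    by apply: le_prob => t [_ it]; exact: fx.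
split; rewrite ?fE//; last exact: aeW.
move=> A; apply: event_measurable.
pose U := \bigcup_(i in setT) grid_cell R q.+1 (i : 'I_q.+1).
have mU (D : set 'I_q.+1) :
    measurable (\bigcup_(i in D) grid_cell R q.+1 (i : 'I_q.+1)).
  by apply: fin_bigcup_measurable => // i _; exact: measurable_itv.
have [A0|nA0] := pselect (A (x ord0)).
- suff -> : f @^-1` A = \bigcup_(i in x @^-1` A) grid_cell R q.+1 i `|` ~` U.
    by apply: measurableU; [exact: mU | apply: measurableC; exact: mU].
  apply/seteqP; split=> t /=.
  + have [[i _ it]|nt] := pselect (U t); last by right.
    by rewrite (fx i)// => Ai; left; exists i.
  + case=> [[i Ai it]|nt]; first by rewrite (fx i).
    by rewrite /f; case: pselect => // -[i it]; case: nt; exists i.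
- suff -> : f @^-1` A = \bigcup_(i in x @^-1` A) grid_cell R q.+1 i.
    exact: mU.
  apply/seteqP; split=> t /=; last by case=> [i Ai it]; rewrite (fx i).
  rewrite {1}/f; case: pselect => // e; case: cid => i /= it Ai.
  by exists i.
Qed.

(** * Distances between complexes and between classes *)

Lemma infimum_ge (R : realType) (A : set R) (b : R) :
  b <= 1 -> lbound A b -> b <= infimum 1 A.
Proof.
move=> b1 Ab; rewrite /infimum; case: ifPn => // /set0P[a Aa].
by case: xgetP => [y _ [_ yA]|_ //]; exact: yA.
Qed.

Lemma infimum_le (R : realType) (A : set R) (a : R) :
  lbound A 0 -> A a -> infimum 1 A <= a.
Proof.
move=> A0 Aa; apply: le_infimum_Nmem => //; exists (inf A); split.
  by move=> y Ay; apply: ge_inf => //; exists 0.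
by move=> y yA; apply: lb_le_inf => //; exists a.
Qed.

Lemma map_dist_ge0 (R : realType) (S : Type) (f g : R -> S) : 0 <= map_dist f g.
Proof. exact: prob_ge0. Qed.

Lemma one_sided_le (R : realType) (S : Type) (K1 K2 : set (set S)) (b : R) :
  0 <= b ->
  (forall f, simplicial_maps R K1 f ->
     exists2 g, simplicial_maps R K2 g & map_dist f g <= b) ->
  one_sided_dist R K1 K2 <= b.
Proof.
move=> b0 H; rewrite /one_sided_dist; set A := [set _ | _ in _].
have [->|A0] := eqVneq A set0; first by rewrite sup0.
apply: ge_sup; first exact/set0P.
move=> _ [f Lf <-]; have [g Lg fg] := H f Lf; apply: le_trans fg.
by apply: infimum_le; [move=> _ [h _ <-]; exact: map_dist_ge0 | exists g].
Qed.

Lemma infimum_dist_le1 (R : realType) (S : Type) (K : set (set S))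
    (f : R -> S) :
  infimum 1 [set map_dist f g | g in simplicial_maps R K] <= 1.
Proof.
set A := [set _ | _ in _]; have [->|/set0P[_ [g Lg _]]] := eqVneq A set0.
  by rewrite /infimum eqxx.
apply: le_trans (prob_le1 R [set t | f t <> g t]).
by apply: infimum_le; [move=> _ [h _ <-]; exact: map_dist_ge0 | exists g].
Qed.

Lemma one_sided_le1 (R : realType) (S : Type) (K1 K2 : set (set S)) :
  one_sided_dist R K1 K2 <= 1.
Proof.
rewrite /one_sided_dist; set A := [set _ | _ in _].
have [->|A0] := eqVneq A set0; first by rewrite sup0.
apply: ge_sup; first exact/set0P.
by move=> _ [f Lf <-]; exact: infimum_dist_le1.
Qed.

Lemma one_sided_ge (R : realType) (S : Type) (K1 K2 : set (set S)) (b : R)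
    (f : R -> S) :
  b <= 1 -> simplicial_maps R K1 f ->
  (forall g, simplicial_maps R K2 g -> b <= map_dist f g) ->
  b <= one_sided_dist R K1 K2.
Proof.
move=> b1 Lf H.
apply: (@le_trans _ _
  (infimum 1 [set map_dist f g | g in simplicial_maps R K2])).
  by apply: infimum_ge => // _ [g Lg <-]; exact: H.
apply: ub_le_sup; last by exists f.
by exists 1 => _ [h _ <-]; exact: infimum_dist_le1.
Qed.

Lemma complex_dist_ge0 (R : realType) (S : Type) (K1 K2 : set (set S)) :
  0 <= complex_dist R K1 K2.
Proof.
rewrite /complex_dist le_max; apply/orP; left.
rewrite /one_sided_dist; set A := [set _ | _ in _].
have [->|/set0P[_ [f Lf _]]] := eqVneq A set0; first by rewrite sup0.
by apply: (one_sided_ge _ _ _ _ 0 f) => // g _; exact: map_dist_ge0.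
Qed.

Lemma complex_dist_le1 (R : realType) (S : Type) (K1 K2 : set (set S)) :
  complex_dist R K1 K2 <= 1.
Proof. by rewrite /complex_dist ge_max !one_sided_le1. Qed.

Lemma simplicial_maps_sub (R : realType) (S : Type) (K1 K2 : set (set S)) :
  K1 `<=` K2 -> simplicial_maps R K1 `<=` simplicial_maps R K2.
Proof. by move=> K12 f [mf Kf fE]; split => //; exact: K12. Qed.

Lemma complex_dist_sub_le (R : realType) (S : Type) (K1 K2 : set (set S))
    (b : R) :
  0 <= b -> K1 `<=` K2 ->
  (forall f, simplicial_maps R K2 f ->
     exists2 g, simplicial_maps R K1 g & map_dist f g <= b) ->
  complex_dist R K1 K2 <= b.
Proof.
move=> b0 K12 H; rewrite /complex_dist ge_max.
apply/andP; split; last exact: one_sided_le.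
apply: one_sided_le => // f Lf; exists f; first exact: simplicial_maps_sub Lf.
suff -> : map_dist f f = prob R set0 by rewrite prob0.
by congr (prob R _); apply/seteqP; split => // t /=; case.
Qed.

Lemma iso_class_refl (S : Type) (K : set (set S)) : iso_class K K.
Proof.
exists id; first by exists id.
apply/seteqP; split=> [E KE|_ [E KE <-]]; last by rewrite image_id.
by exists E; rewrite ?image_id.
Qed.

Lemma class_dist_le (R : realType) (S : Type) (K1 K2 : set (set S)) :
  class_dist R (iso_class K1) (iso_class K2) <= complex_dist R K1 K2.
Proof.
apply: ge_inf; first by exists 0 => _ [K _ <-]; exact: complex_dist_ge0.
by exists (K1, K2) => //; split; exact: iso_class_refl.
Qed.

Lemma class_dist_ge (R : realType) (S : Type) (K1 K2 : set (set S)) (b : R) :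
  (forall s1 s2 : S -> S, bijective s1 -> bijective s2 ->
     b <= complex_dist R (permute s1 K1) (permute s2 K2)) ->
  b <= class_dist R (iso_class K1) (iso_class K2).
Proof.
move=> H; apply: lb_le_inf.
  exists (complex_dist R K1 K2), (K1, K2) => //.
  by split; exact: iso_class_refl.
by move=> _ [[_ _] [[s1 bs1 ->] [s2 bs2 ->]] <-]; exact: H.
Qed.

(** * The lower bound *)

(** The uniform map on x differs from every g on the cells of the indices missed
    by the essential image of g. *)
Lemma one_sided_ge_missing (R : realType) (S : Type) (K1 K2 : set (set S))
    (q p : nat) (x : 'I_q -> S) :
  (0 < q)%N -> (p <= q)%N -> K1 (range x) ->
  (forall G, K2 G -> (p <= #|[pred i | ~~ `[< G (x i) >]]|)%N) ->
  p%:R / q%:R <= one_sided_dist R K1 K2.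
Proof.
case: q x => // q x _ pq K1x missing.
have [f Lf fx] := uniform_map_exists R S K1 q x K1x.
apply: (one_sided_ge _ _ _ _ _ f) => //.
  by rewrite ler_pdivrMr ?ltr0n// mul1r ler_nat.
move=> g [_ K2g gE]; set P := [pred i | ~~ `[< ess_image g (x i) >]].
have N0 : prob R [set t | ~ ess_image g (g t)] = 0.
  by apply: prob_ae0; apply: sub_ae gE => t gE ut nG; exact/nG/gE.
rewrite -[leRHS]addr0 -N0; apply: le_trans (probU_le _ _ _).
apply: (@le_trans _ _
  (prob R (\bigcup_(i in [set` P]) grid_cell R q.+1 (i : 'I_q.+1)))).
  rewrite prob_bigcup; last exact: grid_cell_trivIset.
    under eq_bigr => i _ do rewrite prob_grid_cell//.
    rewrite sumr_const -[leRHS]mulr_natl ler_pM2r ?invr_gt0 ?ltr0n// ler_nat.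
    exact: missing.
  by move=> i; exact: grid_cell_event.
apply: le_prob => t [_ [i /asboolPn nGi it]] /=.
have [fg|] := pselect (f t = g t); last by left.
by right; rewrite -fg (fx i) ?inE.
Qed.

(** The lower bound for a constant map. *)
Lemma one_sided_ge1 (R : realType) (S : Type) (K1 K2 : set (set S)) (v : S) :
  K1 [set v] -> (forall G, K2 G -> ~ G v) -> 1 <= one_sided_dist R K1 K2.
Proof.
move=> K1v K2v.
have rv : range (fun _ : 'I_1 => v) = [set v].
  by apply/seteqP; split=> [_ [_ _ <-] //|_ ->]; exists ord0.
have := @one_sided_ge_missing R S K1 K2 1 1 (fun=> v).
rewrite divr1; apply=> //.
  by rewrite rv.
move=> G /K2v Gv; apply/card_gt0P; exists ord0; rewrite inE; exact/asboolPn.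
Qed.

(** The lower bound for an edge. *)
Lemma one_sided_pair_ge (R : realType) (S : Type) (K1 K2 : set (set S))
    (u v : S) :
  K1 [set u; v] -> (forall G, K2 G -> G u -> ~ G v) ->
  1 / 2 <= one_sided_dist R K1 K2.
Proof.
move=> K1uv K2uv; pose x (i : 'I_2) := if i == ord0 then u else v.
have xE : range x = [set u; v].
  apply/seteqP; split=> [_ [i _ <-]|_ [->|->]].
  - by rewrite /x; case: ifP => _; [left|right].
  - by exists ord0.
  - by exists ord_max.
apply: (one_sided_ge_missing _ _ _ _ 2 1 x) => //; first by rewrite xE.
move=> G KG; apply/card_gt0P; have [Gu|nGu] := pselect (G u).
  by exists ord_max; rewrite inE; apply/asboolPn; exact: (K2uv _ KG Gu).
by exists ord0; rewrite inE; exact/asboolPn.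
Qed.

Lemma card_finset (I : finType) (A : {set I}) : ([set` A] #= `I_#|A|)%card.
Proof.
have -> : [set` A] = range (enum_val : 'I_#|A| -> I).
  apply/seteqP; split=> [i /= iA|_ [j _ <-] /=]; last exact: enum_valP.
  by exists (enum_rank_in iA i) => //; rewrite enum_rankK_in.
apply: card_eq_trans (card_esym card_II).
by apply: inj_card_eq => i j _ _; exact: enum_val_inj.
Qed.

Lemma missing_count (S : Type) (q p : nat) (x : 'I_q -> S) (G : set S) :
  injective x -> (p <= q)%N -> (G `&` range x #<= `I_(q - p))%card ->
  (p <= #|[pred i | ~~ `[< G (x i) >]]|)%N.
Proof.
move=> xinj pq Gcard; pose P := [set i | `[< G (x i) >]]%SET.
have Pq : (#|P| <= q - p)%N.
  rewrite -card_le_II -(card_le_eql (card_finset _ P)).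
  rewrite -(card_le_eql (inj_card_eq (in2W xinj))).
  apply: card_le_trans Gcard; apply: subset_card_le => _ [i /= iP <-].
  by split; last exists i; move: iP; rewrite inE => /asboolP.
have Pc : (#|P| + #|[predC P]|)%N = q by rewrite cardC card_ord.
have -> : #|[pred i | ~~ `[< G (x i) >]]| = #|[predC P]|.
  by apply: eq_card => i; rewrite !inE.
by move: Pq pq Pc; lia.
Qed.

(** * The upper bound *)

Lemma card_enum (S : Type) (X : set S) (q : nat) : (X #= `I_q)%card ->
  exists2 x : 'I_q -> S, injective x & X = range x.
Proof.
move=> /card_set_bijP[f [fX finj fsurj]].
have /choice[x xP] (i : 'I_q) : exists s, X s /\ f s = i.
  by have [s Xs <-] := fsurj i (ltn_ord i); exists s.
exists x.
  move=> i j xij; apply: val_inj.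
  by rewrite /= -(xP i).2 -(xP j).2 xij.
apply/seteqP; split=> [s Xs|_ [i _ <-]]; last exact: (xP i).1.
exists (Ordinal (fX s Xs)) => //; apply: finj; rewrite ?inE//.
  exact: (xP _).1.
exact: (xP _).2.
Qed.

(** The p lightest of the n elements of A have total weight at most p/n times
    the total weight. Removing a heaviest element i of A, whose weight bounds
    that of each of the p elements of B, gives the step from n - 1 to n. *)
Lemma light_subset (R : realFieldType) (I : finType) (w : I -> R) (p : nat)
    (A : {set I}) :
  (p <= #|A|)%N ->
  exists B : {set I}, [/\ B \subset A, #|B| = p &
    #|A|%:R * \sum_(i in B) w i <= p%:R * \sum_(i in A) w i].
Proof.
have [n] := ubnP #|A|; elim: n A => // n IHn A /ltnSE An pA.
have [Ap|Ap] := eqVneq #|A| p; first by exists A; rewrite Ap.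
have {Ap pA} pA : (p < #|A|)%N by rewrite ltn_neqAle eq_sym Ap.
have /card_gt0P [i0 i0A] : (0 < #|A|)%N by exact: leq_ltn_trans pA.
have [i memAi wmax] := Order.TotalTheory.arg_maxP w i0A.
have iA : i \in A by [].
have A' := cardsD1 i A; rewrite iA add1n in A'.
have [||B [BA' Bp IH]] := IHn (A :\ i).
- by rewrite -A'.
- by rewrite -ltnS -A'.
have BA : B \subset A by apply: (fintype.subset_trans BA'); exact: subD1set.
exists B; split => //; rewrite A' [X in _ <= _ * X](big_setD1 i)//=.
rewrite -natr1 mulrDl mul1r mulrDr addrC lerD//.
rewrite -Bp mulr_natl -sumr_const ler_sum// => j jB.
by apply: wmax; exact: (fintype.subsetP BA).
Qed.

(** The map g is obtained from f by sending its p least frequent values to some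
    other value x a, which exists because p < q. *)
Lemma recolour_light (R : realType) (S : Type) (K : set (set S)) (q p : nat)
    (x : 'I_q -> S) (f : R -> S) :
  injective x -> (p < q)%N -> simplicial_maps R K f ->
  finite_parts (range x) (ess_image f) ->
  exists2 g, simplicial_maps R (finite_parts_le (q - p) (range x)) g &
    map_dist f g <= p%:R / q%:R.
Proof.
move=> xinj pq Lf [fX _ [s0 fs0]]; have [mf _ _] := Lf.
have tF : trivIset setT (fun i => f @^-1` [set x i]).
  by move=> i j _ _ [t [/= -> /xinj]].
have [|B [_ Bp wB]] :=
    light_subset R _ (fun i => prob R (f @^-1` [set x i])) p [set: 'I_q]%SET.
  by rewrite cardsT card_ord ltnW.
have [a aB] : exists a, a \notin B.
  apply/existsP; rewrite -negb_forall; apply/negP => /forallP allB.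
  have BT : B = [set: 'I_q]%SET by apply/setP => i; rewrite allB inE.
  by move: pq; rewrite -Bp BT cardsT card_ord ltnn.
pose phi s := if pselect (exists2 i, i \in B & x i = s) then x a else s.
have phiE s : phi s <> s -> exists2 i, i \in B & x i = s.
  by rewrite /phi; case: pselect.
have phiX s : ess_image f s -> (x @` [set` (~: B)%SET]) (phi s).
  move=> /fX[j _ <-]; rewrite /phi; case: pselect => [jB|nB].
    exists a; by rewrite /= ?inE.
  by exists j; rewrite //= inE; apply/negP => jB; apply: nB; exists j.
have card_phi : (phi @` ess_image f #<= `I_(q - p))%card.
  have -> : (q - p)%N = #|(~: B)%SET|.
    by rewrite cardsCs finset.setCK Bp card_ord.
  rewrite -(card_le_eqr (card_finset _ _)).
  apply: card_le_trans (card_image_le x _).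
  by apply: subset_card_le => _ [s /phiX ? <-].
exists (phi \o f).
  apply: simplicial_maps_comp Lf _; split => //; split.
  - by move=> _ [s /phiX[i _ <-] <-]; exists i.
  - by apply: card_le_finite card_phi _.
  - by exists (phi s0), s0.
apply: (@le_trans _ _ (prob R (\bigcup_(i in [set` B]) f @^-1` [set x i]))).
  by apply: le_prob => t [_ /= /nesym/phiE[i iB xi]]; exists i.
have q0 : 0 < q%:R :> R by rewrite ltr0n (leq_ltn_trans _ pq).
have mF i : event R (f @^-1` [set x i]) by exact: mf.
rewrite ler_pdivlMr// mulrC prob_bigcup//.
rewrite cardsT card_ord in wB; apply: le_trans wB _.
rewrite -[leRHS]mulr1 ler_wpM2l ?ler0n//.
by rewrite -prob_bigcup// prob_le1.
Qed.

(** * Isomorphism classes whose vertex sets are not equipotent *)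

Lemma simplicial_complex_set1 (S : Type) (K : set (set S)) (v : S) :
  simplicial_complex K -> vertices K v -> K [set v].
Proof.
by move=> [_ Ksub] [E KE Ev]; apply: (Ksub E) => //; [exists v | move=> _ ->].
Qed.

Lemma simplicial_complex_permute (S : Type) (s : S -> S) (K : set (set S)) :
  simplicial_complex K -> simplicial_complex (permute s K).
Proof.
move=> [Kfin Ksub].
split=> [_ [E /Kfin[_ Efin [v Ev]] <-]|_ F [E KE <-] [v Fv] FE].
  by split => //; [exact: finite_image | exists (s v), v].
exists (E `&` s @^-1` F).
  apply: (Ksub E) => //; have [w Ew sw] := FE v Fv; exists w; split => //.
  by rewrite /= sw.
apply/seteqP; split=> [_ [w [_ Fsw] <-] //|w Fw].
by have [u Eu su] := FE w Fw; exists u => //; split => //=; rewrite su.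
Qed.

Lemma vertices_permute (S : Type) (s : S -> S) (K : set (set S)) :
  vertices (permute s K) = s @` vertices K.
Proof.
apply/seteqP; split=> [_ [_ [E KE <-] [v Ev <-]]|_ [v [E KE Ev] <-]].
  by exists v => //; exists E.
by exists (s @` E); [exists E | exists v].
Qed.

Lemma vertices_eq (R : realType) (S : Type) (K1 K2 : set (set S)) :
  simplicial_complex K1 -> simplicial_complex K2 ->
  complex_dist R K1 K2 < 1 -> vertices K1 = vertices K2.
Proof.
move=> K1c K2c; rewrite /complex_dist gt_max !ltNge => /andP[d12 d21].
apply/seteqP; split=> v Kv; apply: contrapT => nKv; [move: d12|move: d21];
  apply/negP; rewrite negbK; apply: (one_sided_ge1 _ _ _ _ v);
  by [exact: simplicial_complex_set1 | move=> G KG Gv; apply: nKv; exists G].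
Qed.

Lemma class_dist_distinct_vertices (R : realType) (S : Type)
    (K1 K2 : set (set S)) :
  simplicial_complex K1 -> simplicial_complex K2 ->
  ~ (vertices K1 #= vertices K2)%card ->
  class_dist R (iso_class K1) (iso_class K2) = 1.
Proof.
move=> K1c K2c neq; apply/eqP; rewrite eq_le; apply/andP; split.
  exact: le_trans (class_dist_le _ _ _ _) (complex_dist_le1 _ _ _ _).
apply: class_dist_ge => s1 s2 /bij_inj s1i /bij_inj s2i.
rewrite leNgt; apply/negP => /vertices_eq.
move=> /(_ (simplicial_complex_permute _ _ _ K1c)
           (simplicial_complex_permute _ _ _ K2c)).
rewrite !vertices_permute => e; apply: neq.
apply: card_eq_trans (inj_card_eq (in2W s2i)); rewrite -e.
exact/card_esym/(inj_card_eq (in2W s1i)).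
Qed.

(** * A simplex and its skeleton *)

Lemma finite_parts_le_sub (S : Type) (k : nat) (X : set S) :
  finite_parts_le k X `<=` finite_parts X.
Proof. by move=> E []. Qed.

Lemma finite_parts_range (S : Type) (q : nat) (x : 'I_q -> S) :
  (0 < q)%N -> finite_parts (range x) (range x).
Proof.
case: q x => // q x _; split => //; last by exists (x ord0), ord0.
exact/finite_image/finite_finset.
Qed.

(** For p = q the skeleton is the empty complex, at distance 1 = p/q. *)
Lemma class_dist_skeleton (R : realType) (S : Type) (X : set S) (q p : nat) :
  (X #= `I_q)%card -> (1 <= q)%N -> (1 <= p)%N -> (p <= q)%N ->
  class_dist R (iso_class (finite_parts_le (q - p) X))
    (iso_class (finite_parts X)) = p%:R / q%:R.
Proof.
move=> /card_enum[x xinj ->] q0 _ pq.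
apply/eqP; rewrite eq_le; apply/andP; split.
  apply: le_trans (class_dist_le _ _ _ _) _.
  have [{}pq|qp] := ltnP p q; last first.
    have -> : p = q by apply/eqP; rewrite eqn_leq pq.
    by rewrite divff ?complex_dist_le1// pnatr_eq0 -lt0n.
  apply: complex_dist_sub_le; first by rewrite divr_ge0.
    exact: finite_parts_le_sub.
  move=> f Lf; apply: (recolour_light _ _ _ _ _ _ _ xinj pq Lf).
  by case: Lf.
apply: class_dist_ge => s1 s2 _ /bij_inj s2i.
rewrite /complex_dist le_max; apply/orP; right.
have sxi : injective (s2 \o x) by exact: inj_comp.
apply: (one_sided_ge_missing _ _ _ _ _ _ (s2 \o x)) => //.
  exists (range x); first exact: finite_parts_range.
  by rewrite image_comp.
move=> _ [F [_ Fcard] <-]; apply: missing_count => //.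
apply: card_le_trans (subset_card_le (@subIsetl _ _ _)) _.
exact: card_le_trans (card_image_le _ _) Fcard.
Qed.

(** * Disjoint unions of simplices and of their skeleta *)

Lemma simplicial_complex_skeleta (S I : Type) (k : I -> nat) (X : I -> set S) :
  simplicial_complex (\bigcup_n finite_parts_le (k n) (X n)).
Proof.
split=> [E [n _ [[_ Efin E0] _]]|E F [n _ [[EX Efin _] Ek]] F0 FE].
  by split.
exists n => //; split; last exact: card_le_trans (subset_card_le FE) Ek.
by split => //; [exact: subset_trans EX | exact: sub_finite_set Efin].
Qed.

Lemma simplicial_complex_simplices (S I : Type) (X : I -> set S) :
  simplicial_complex (\bigcup_n finite_parts (X n)).
Proof.
split=> [E [n _ [_ Efin E0]]|E F [n _ [EX Efin _]] F0 FE]; first by split.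
exists n => //.
by split => //; [exact: subset_trans EX | exact: sub_finite_set Efin].
Qed.

Lemma vertices_skeleta (S : Type) (I : Type) (k : I -> nat) (X : I -> set S) :
  (forall n, 0 < k n)%N ->
  vertices (\bigcup_n finite_parts_le (k n) (X n)) = \bigcup_n X n.
Proof.
move=> k0; apply/seteqP; split=> [v [E [n _ [[EX _ _] _]] Ev]|v [n _ Xv]].
  by exists n => //; exact: EX.
exists [set v] => //; exists n => //; split.
  by split=> [_ ->| |] //; exists v.
by rewrite (card_le_eql card_set1) card_le_II.
Qed.

Lemma vertices_simplices (S : Type) (I : Type) (X : I -> set S) :
  vertices (\bigcup_n finite_parts (X n)) = \bigcup_n X n.
Proof.
apply/seteqP; split=> [v [E [n _ [EX _ _]] Ev]|v [n _ Xv]].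
  by exists n => //; exact: EX.
by exists [set v] => //; exists n => //; split=> [_ ->| |] //; exists v.
Qed.

(** Strong induction on n. A point of A n lies in some B m, which is contained
    in a block of A, hence in A n by disjointness. Comparing sizes, m <= n. If
    m < n, then the nonempty set B m = A m is both contained in A n and disjoint
    from it, which is impossible; so m = n. *)
Lemma blocks_eq (S : Type) (A B : nat -> set S) (q : nat -> nat) :
  trivIset [set: nat] A ->
  (forall n, (A n #= `I_(q n))%card) -> (forall n, (B n #= `I_(q n))%card) ->
  (forall m n, (m < n)%N -> (q m < q n)%N) ->
  (forall n, A n !=set0) -> (forall n, B n !=set0) ->
  \bigcup_n A n = \bigcup_n B n ->
  (forall m, exists k, B m `<=` A k) ->
  forall n, A n = B n.
Proof.
move=> tA Aq Bq q_incr A0 B0 AB BA.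
elim/ltn_ind => k IH.
have key v : A k v -> B k v /\ B k `<=` A k.
  move=> Akv.
  have [m _ Bmv] : (\bigcup_n B n) v by rewrite -AB; exists k.
  have [j BmA] := BA m.
  have jk : j = k by apply: tA => //; exists v; split => //; exact: BmA.
  rewrite {}jk in BmA.
  have qmk : (q m <= q k)%N.
    rewrite -card_le_II -(card_le_eql (Bq m)) -(card_le_eqr (Aq k)).
    exact: subset_card_le.
  have [mk|km|mk] := ltngtP m k.
  - have [w Bmw] := B0 m; have mEk : m = k.
      by apply: tA => //; exists w; split; [rewrite IH | exact: BmA].
    by move: mk; rewrite mEk ltnn.
  - by move: (q_incr _ _ km); rewrite ltnNge qmk.
  - by move: BmA Bmv; rewrite mk => ? ?; split.
have [v0 /key[_ BkA]] := A0 k.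
by apply/seteqP; split => // w /key[].
Qed.

Lemma class_dist_disjoint_skeleta (R : realType) (S : Type)
    (Sn : nat -> set S) (q p : nat -> nat) (alpha : R) :
  trivIset [set: nat] Sn ->
  (forall n, (Sn n #= `I_(q n))%card) ->
  (forall n, (1 <= p n)%N) ->
  (forall n, (p n <= q n)%N) ->
  alpha = sup (range (fun n => (p n)%:R / (q n)%:R : R)) ->
  alpha <= 1 / 2 ->
  (forall m n : nat, (m < n)%N -> (q m < q n)%N) ->
  class_dist R
    (iso_class (\bigcup_n finite_parts_le (q n - p n) (Sn n)))
    (iso_class (\bigcup_n finite_parts (Sn n))) = alpha.
Proof.
move=> tS Sq p0 pq alphaE alpha2 q_incr.
have q0 n : (0 < q n)%N by exact: leq_trans (pq n).
have q0R n : 0 < (q n)%:R :> R by rewrite ltr0n.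
pose ratios : set R := range (fun n => (p n)%:R / (q n)%:R).
have ratios_sup : has_sup ratios.
  split; first by exists ((p 0%N)%:R / (q 0%N)%:R), 0%N.
  by exists 1 => _ [n _ <-]; rewrite ler_pdivrMr// mul1r ler_nat.
have ratio_le n : (p n)%:R / (q n)%:R <= alpha.
  by rewrite alphaE; apply: ub_le_sup; [exact: ratios_sup.2 | exists n].
have alpha0 : 0 <= alpha by apply: le_trans (ratio_le 0%N); rewrite divr_ge0.
have {}pq n : (p n < q n)%N.
  rewrite -(ltr_nat R) -[ltRHS]mul1r -ltr_pdivrMr//.
  by apply: le_lt_trans (ratio_le n) _; apply: le_lt_trans alpha2 _; lra.
apply/eqP; rewrite eq_le; apply/andP; split.
  apply: le_trans (class_dist_le _ _ _ _) _; apply: complex_dist_sub_le => //.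
    by move=> E [n _ [En _]]; exists n.
  move=> f Lf; have [_ [n _ fSn] _] := Lf.
  have [x xinj xE] := card_enum _ _ _ (Sq n); rewrite xE in fSn.
  have [g Lg fg] := recolour_light _ _ _ _ _ _ _ xinj (pq n) Lf fSn.
  exists g; last exact: le_trans fg (ratio_le n).
  by apply: simplicial_maps_sub Lg => E; rewrite -xE => En; exists n.
apply: class_dist_ge => s1 s2 /bij_inj s1i /bij_inj s2i; rewrite leNgt.
set K1 := \bigcup_n finite_parts_le _ _; set K2 := \bigcup_n finite_parts _.
set d := complex_dist _ _ _; apply/negP => d_alpha.
have [n dn] : exists n, d < (p n)%:R / (q n)%:R.
  have d_sup : d < sup ratios by rewrite -alphaE.
  by have [_ [n _ <-] dn] := sup_gt ratios_sup.1 d_sup; exists n.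
have d2 : d < 1 / 2 by exact: lt_le_trans d_alpha alpha2.
have K1c : simplicial_complex (permute s1 K1).
  exact/simplicial_complex_permute/simplicial_complex_skeleta.
have K2c : simplicial_complex (permute s2 K2).
  exact/simplicial_complex_permute/simplicial_complex_simplices.
pose A n := s1 @` Sn n; pose B n := s2 @` Sn n.
have S0 m : Sn m !=set0.
  have [x _ ->] := card_enum _ _ _ (Sq m).
  by exists (x (Ordinal (q0 m))); exists (Ordinal (q0 m)).
have tA : trivIset [set: nat] A.
  move=> i j _ _ [_ [[u Su <-] [v Sv /s1i vu]]].
  by apply: tS => //; exists u; split => //; rewrite -vu.
have K1A G : permute s1 K1 G ->
    exists2 m, G `<=` A m & (G #<= `I_(q m - p m))%card.
  move=> [F [m _ [[FS _ _] Fq]] <-]; exists m; first exact: image_subset.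
  exact: card_le_trans (card_image_le _ _) Fq.
have K2B m : permute s2 K2 (B m).
  exists (Sn m) => //; exists m => //; split => //.
  by apply: card_le_finite (finite_II (q m)); rewrite (card_le_eql (Sq m)).
have AB : \bigcup_n A n = \bigcup_n B n.
  have := vertices_eq R _ _ _ K1c K2c; rewrite !vertices_permute.
  rewrite vertices_skeleta ?vertices_simplices; last first.
    by move=> m; rewrite subn_gt0.
  by rewrite !image_bigcup; apply; apply: lt_trans d2 _; lra.
(* Any two points of B m lie in a common A k; fixing one of them fixes k. *)
have BA m : exists k, B m `<=` A k.
  have pair u v : B m u -> B m v -> exists2 k, A k u & A k v.
    move=> Bu Bv; apply: contrapT => nk.
    move: d2; rewrite ltNge => /negP; apply.
    rewrite le_max; apply/orP; right; apply: (one_sided_pair_ge _ _ _ _ u v).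
      by apply: (K2c.2 (B m)) => //; [exists u; left | move=> _ [->|->]].
    by move=> G /K1A[k GA _] Gu Gv; apply: nk; exists k; exact: GA.
  have [u0 Su0] := S0 m; have Bu0 : B m (s2 u0) by exists u0.
  have [k ku0 _] := pair _ _ Bu0 Bu0; exists k => v Bv.
  have [j ju0 jv] := pair _ _ Bu0 Bv.
  by have <- : j = k by apply: tA => //; exists (s2 u0).
(* Hence the simplices contained in A m with m != n are disjoint from B n. *)
have ABn : A n = B n.
  apply: (@blocks_eq _ A B q) => // m.
  - exact: card_eq_trans (inj_card_eq (in2W s1i)) (Sq m).
  - exact: card_eq_trans (inj_card_eq (in2W s2i)) (Sq m).
  - by have [u Su] := S0 m; exists (s1 u), u.
  - by have [u Su] := S0 m; exists (s2 u), u.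
move: dn; rewrite ltNge => /negP; apply.
rewrite le_max; apply/orP; right.
have [x xinj xE] := card_enum _ _ _ (Sq n).
have sxi : injective (s2 \o x) by exact: inj_comp.
have sxE : range (s2 \o x) = B n by rewrite /B xE image_comp.
apply: (one_sided_ge_missing _ _ _ _ _ _ (s2 \o x)) => //.
- exact: ltnW.
- by rewrite sxE.
move=> G /K1A[m GA Gq]; apply: missing_count => //; first exact: ltnW.
rewrite sxE -ABn; have [mn|mn] := eqVneq m n.
  by rewrite -mn; exact: card_le_trans (subset_card_le (@subIsetl _ _ _)) Gq.
suff -> : G `&` A n = set0 by exact: card_ge0.
apply/seteqP; split => // v [/GA Amv Anv] /=.
by move/eqP: mn; apply; apply: tA => //; exists v.
Qed.

Theorem proposition4p6 (R : realType) (S : Type) :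
  [/\ (forall K1 K2 : set (set S),
         simplicial_complex K1 -> simplicial_complex K2 ->
         ~ (vertices K1 #= vertices K2)%card ->
         class_dist R (iso_class K1) (iso_class K2) = 1),
      (forall (X : set S) (q p : nat),
         (X #= `I_q)%card -> (1 <= q)%N -> (1 <= p)%N -> (p <= q)%N ->
         class_dist R (iso_class (finite_parts_le (q - p) X))
                      (iso_class (finite_parts X)) = p%:R / q%:R)
    & (forall (Sn : nat -> set S) (q p : nat -> nat) (alpha : R),
         trivIset [set: nat] Sn ->
         (forall n, (Sn n #= `I_(q n))%card) ->
         (forall n, (1 <= p n)%N) ->
         (forall n, (p n <= q n)%N) ->
         alpha = sup (range (fun n => (p n)%:R / (q n)%:R : R)) ->
         alpha <= 1 / 2 ->
         (forall m n : nat, (m < n)%N -> (q m < q n)%N) ->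
         class_dist R
           (iso_class (\bigcup_n finite_parts_le (q n - p n) (Sn n)))
           (iso_class (\bigcup_n finite_parts (Sn n))) = alpha)].
Proof.
split; first exact: class_dist_distinct_vertices.
- exact: class_dist_skeleton.
- exact: class_dist_disjoint_skeleta.
Qed.
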